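(* Let $$M_8=\begin{pmatrix}0&0\\ \ast&1\end{pmatrix},\quad M_9=\begin{pmatrix}0&1\\ 0&1\end{pmatrix},\quad M_{10}=\begin{pmatrix}0&0\\ 0&1\end{pmatrix}.$$ Then: (i) the minimal $M_8$-obstructions are exactly the digraphs on three vertices that admit no $M_8$-partition, together with all superorientations of $2K_2$; (ii) the minimal $M_9$-obstructions are exactly the digraphs on three vertices that admit no $M_9$-partition; (iii) the minimal $M_{10}$-obstructions are exactly the asymmetric arc (two vertices joined by exactly one arc), the biorientation of $2K_2$, and the biorientation of the path $P_3$ on three vertices.
   Context: Digraphs have no loops and no multiple arcs in the same direction. Given a $2\times2$ matrix $M$ over $\{0,1,\ast\}$, an $M$-partition of a digraph $D$ is a partition of $V_D$ into parts $V_1,V_2$ (possibly empty) such that: for each $i$, two distinct vertices of $V_i$ are non-adjacent if $M_{i,i}=0$, and joined by arcs in both directions if $M_{i,i}=1$; for $i\neq j$, every vertex of $V_i$ has an arc to every vertex of $V_j$ if $M_{i,j}=1$, and no vertex of $V_i$ has an arc to any vertex of $V_j$ if $M_{i,j}=0$; $\ast$ imposes no restriction. A minimal $M$-obstruction is a digraph that admits no $M$-partition but every proper induced subdigraph of which admits one. A superorientation of a graph $G$ is a digraph obtained by replacing each edge $xy$ of $G$ by the arc $(x,y)$, the arc $(y,x)$, or both. The biorientation of $G$ replaces every edge by arcs in both directions. $2K_2$ is the graph consisting of two disjoint edges; $P_3$ is the path with three vertices. *)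

(* Defs.v *)
From HB Require Import structures.
From mathcomp Require Import all_boot all_order all_algebra.
Set Implicit Arguments.
Unset Strict Implicit.
Unset Printing Implicit Defensive.

(* Finite digraphs without loops; [arc] being a relation, there is at most one
   arc in each direction. *)
Record digraph := Digraph {
  vertex :> finType;
  arc : rel vertex;
  arc_irr : irreflexive arc }.

Definition diso (D D' : digraph) : Prop :=
  exists2 f : D -> D', bijective f & forall x y, arc (f x) (f y) = arc x y.

Lemma induced_irr (D : digraph) (S : {set D}) :
  irreflexive (fun x y : {x : D | x \in S} => arc (val x) (val y)).
Proof. by move=> x; rewrite arc_irr. Qed.

Definition induced (D : digraph) (S : {set D}) : digraph :=
  Digraph (@induced_irr D S).

Inductive entry := Zero | One | Star.

Definition mx2x2 (a b c d : entry) : 'M[entry]_2 :=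
  \matrix_(i, j) if i == ord0 then (if j == ord0 then a else b)
                 else (if j == ord0 then c else d).

(* The last clause ranges over ordered pairs of distinct vertices: for [i = j]
   it therefore speaks of both directions, and for [i != j] it only constrains
   the arcs from [V i] to [V j]. *)
Definition is_Mpartition (M : 'M[entry]_2) (D : digraph) (V : 'I_2 -> {set D})
    : Prop :=
  [/\ \bigcup_i V i = [set: D],
      forall i j, i != j -> [disjoint V i & V j]
    & forall i j (x y : D), x \in V i -> y \in V j -> x != y ->
        match M i j with
        | Zero => ~~ arc x y
        | One => arc x y
        | Star => true
        end].

Definition has_Mpartition (M : 'M[entry]_2) (D : digraph) : Prop :=
  exists V : 'I_2 -> {set D}, is_Mpartition M V.

Definition minimal_obstruction (M : 'M[entry]_2) (D : digraph) : Prop :=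
  ~ has_Mpartition M D /\
  forall S : {set D}, S \proper [set: D] -> has_Mpartition M (induced S).

Record sgraph := SGraph {
  svertex :> finType;
  edge : rel svertex;
  edge_sym : symmetric edge;
  edge_irr : irreflexive edge }.

(* Up to isomorphism: [f] identifies the vertices of [D] with those of [G]. *)
Definition is_superorientation (G : sgraph) (D : digraph) : Prop :=
  exists2 f : D -> G, bijective f &
    forall x y, edge (f x) (f y) = arc x y || arc y x.

Definition biorientation (G : sgraph) : digraph := Digraph (@edge_irr G).

(* The first component selects one of the two copies of K_2. *)
Definition twoK2_edge : rel ('I_2 * 'I_2) :=
  fun x y => (x.1 == y.1) && (x.2 != y.2).

Lemma twoK2_sym : symmetric twoK2_edge.
Proof. by move=> x y; rewrite /twoK2_edge eq_sym [x.2 == _]eq_sym. Qed.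

Lemma twoK2_irr : irreflexive twoK2_edge.
Proof. by move=> x; rewrite /twoK2_edge !eqxx. Qed.

Definition twoK2 : sgraph := SGraph twoK2_sym twoK2_irr.

Definition P3_edge : rel 'I_3 := fun i j => (i.+1 == j) || (j.+1 == i).

Lemma P3_sym : symmetric P3_edge.
Proof. by move=> i j; rewrite /P3_edge orbC. Qed.

Lemma P3_irr : irreflexive P3_edge.
Proof. by move=> i; rewrite /P3_edge orbb gtn_eqF. Qed.

Definition P3 : sgraph := SGraph P3_sym P3_irr.

Lemma asym_irr : irreflexive (fun i j : 'I_2 => i < j).
Proof. by move=> i; rewrite ltnn. Qed.

Definition asymmetric_arc : digraph := Digraph asym_irr.

Definition M8 : 'M[entry]_2 := mx2x2 Zero Zero
                                     Star One.

Definition M9 : 'M[entry]_2 := mx2x2 Zero One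
                                     Zero One.

Definition M10 : 'M[entry]_2 := mx2x2 Zero Zero
                                      Zero One.

(* Main.v *)
(** An [M8]-partition can always take [V_1] to be the set of sinks, so it exists
    iff any two distinct non-sinks are joined in both directions; a violation
    of this involves two arcs, hence at most four vertices.  An [M9]-partition
    exists iff every vertex receives arcs from all other vertices or from none,
    and an [M10]-partition exists iff the digraph is symmetric and has an
    [M8]-partition. *)
From Corelib Require Import Setoid.
Require Import Defs.
From mathcomp Require Import all_boot all_order all_algebra.
(* [Defs.arc] must shadow [path.arc]. *)
Import Defs.

Set Implicit Arguments.
Unset Strict Implicit.
Unset Printing Implicit Defensive.

(** * Partitions as conditions on arcs *)

Definition complies (e : entry) (b : bool) : bool :=
  match e with Zero => ~~ b | One => b | Star => true end.

Lemma ord2P (i : 'I_2) : i = ord0 \/ i = ord_max.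
Proof. by case: i => [[|[|i]] // i2]; [left | right]; apply: val_inj. Qed.

(** The first part is the complement of the second, [B], so a partition amounts to the choice of one
    set, and membership in [B] selects the matrix entry. *)
Lemma has_MpartitionP a b c d (D : digraph) :
  has_Mpartition (mx2x2 a b c d) D <->
  exists B : {set D}, forall x y, x != y ->
    complies (if x \in B then if y \in B then d else c
              else if y \in B then b else a) (arc x y).
Proof.
split=> [[V [Vcover Vdisj VM]]|[B BM]].
  have V0 x : x \notin V ord_max -> x \in V ord0.
    have : x \in \bigcup_i V i by rewrite Vcover inE.
    by rewrite big_ord_recl big_ord1 inE (_ : lift _ _ = ord_max)
         => [/orP[//|->]|]; last exact/val_inj.
  exists (V ord_max) => x y xy.
  case: ifPn => [xV|/V0 xV]; case: ifPn => [yV|/V0 yV];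
    by have := VM _ _ _ _ xV yV xy; rewrite mxE /=; case: (arc x y).
exists (fun i => if i == ord0 then ~: B else B); split.
- apply/setP=> x; rewrite big_ord_recl big_ord1 !inE /=.
  by case: (x \in B).
- move=> i j; rewrite disjoints_subset.
  by case: (ord2P i) => ->; case: (ord2P j) => -> //= _; rewrite ?setCK.
- move=> i j x y + + /BM; rewrite mxE.
  case: (i == ord0); case: (j == ord0); rewrite ?inE;
    do 2![move=> /negPf-> | move=> ->];
    by rewrite /complies; case: (X in match X with Zero => _ | _ => _ end).
Qed.

Lemma arc_neq (D : digraph) (x y : D) : arc x y -> x != y.
Proof. by apply: contraTneq => ->; rewrite arc_irr. Qed.

(** The zero first row forbids arcs leaving the first part, so every non-sink lies in the second;
    [x'] and [y'] witness that [x] and [y] are non-sinks. *)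
Lemma has_M8P (D : digraph) :
  has_Mpartition M8 D <->
  forall x x' y y' : D, arc x x' -> arc y y' -> x != y -> arc x y.
Proof.
rewrite has_MpartitionP; split=> [[B BM] x x' y y' xx' yy' xy|D8].
  have inB u v : arc u v -> u \in B.
    by move=> uv; have := BM _ _ (arc_neq uv); rewrite uv;
      case: (u \in B) => //; case: (v \in B).
  by have := BM _ _ xy; rewrite (inB _ _ xx') (inB _ _ yy').
exists [set x | [exists y, arc x y]] => x y xy; rewrite !inE.
case: existsP => [[x' xx']|nx].
  by case: existsP => [[y' yy']|//]; exact: D8 xx' yy' xy.
by case: ifP => _; apply/negP=> a; case: nx; exists y.
Qed.

(** The two entries in each column of [M9] agree, so the part of [z] alone decides whether [z]
    receives arcs from all other vertices or from none. *)
Lemma has_M9P (D : digraph) :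
  has_Mpartition M9 D <->
  forall x y z : D, x != z -> y != z -> arc x z = arc y z.
Proof.
rewrite has_MpartitionP; split=> [[B BM] x y z xz yz|D9].
  have arcB u : u != z -> arc u z = (z \in B).
    by move/BM; case: (u \in B); case: (z \in B) => //= /negPf.
  by rewrite !arcB.
exists [set y | [exists x, arc x y]] => x y xy; rewrite !inE.
have -> : [exists z, arc z y] = arc x y.
  apply/existsP/idP => [[z zy]|]; last by exists x.
  by rewrite (D9 x z) ?(arc_neq zy).
by case: ifP => _; case: (arc x y).
Qed.

(** [M10] makes the arcs exactly the ordered pairs of distinct vertices of the second part.
    Conversely, symmetry excludes the arcs from non-sinks to sinks that [M8] allows, since their
    reversals would leave a sink. *)
Lemma has_M10P (D : digraph) :
  has_Mpartition M10 D <-> symmetric (@arc D) /\ has_Mpartition M8 D.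
Proof.
rewrite has_M8P has_MpartitionP; split=> [[B BM]|[Dsym D8]].
  have arcB x y : arc x y = [&& x != y, x \in B & y \in B].
    have [->|/BM] := eqVneq x y; first by rewrite arc_irr.
    by case: (x \in B); case: (y \in B) => //= /negPf.
  split=> [x y|x x' y y']; rewrite !arcB;
    first by rewrite eq_sym [X in _ && X]andbC.
  by case/and3P=> _ -> _ /and3P[_ -> _] ->.
have nonsink x y : arc x y -> [exists z, arc x z].
  by move=> xy; apply/existsP; exists y.
exists [set x | [exists y, arc x y]] => x y xy; rewrite !inE.
case: existsP => [[x' xx']|nx].
  case: existsP => [[y' yy']|ny]; first exact: D8 xx' yy' xy.
  by apply/negP=> a; case: ny; exists x; rewrite Dsym.
by case: ifP => _; apply/negP=> a; case: nx; exists y.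
Qed.

(** * Restriction to induced subdigraphs *)

Lemma has_M8_inducedP (D : digraph) (S : {set D}) :
  has_Mpartition M8 (induced S) <->
  {in S & S, forall x x', {in S & S, forall y y',
     arc x x' -> arc y y' -> x != y -> arc x y}}.
Proof.
rewrite has_M8P; split=> [S8 x x' xS x'S y y' yS y'S
  |S8 [x xS] [x' x'S] [y yS] [y' y'S]].
  exact: (S8 (Sub x xS) (Sub x' x'S) (Sub y yS) (Sub y' y'S)).
exact: S8.
Qed.

Lemma has_M9_inducedP (D : digraph) (S : {set D}) :
  has_Mpartition M9 (induced S) <->
  {in S & &, forall x y z, x != z -> y != z -> arc x z = arc y z}.
Proof.
rewrite has_M9P; split=> [S9 x y z xS yS zS|S9 [x xS] [y yS] [z zS]].
  exact: (S9 (Sub x xS) (Sub y yS) (Sub z zS)).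
exact: S9.
Qed.

Lemma has_M10_inducedP (D : digraph) (S : {set D}) :
  has_Mpartition M10 (induced S) <->
  {in S &, symmetric (@arc D)} /\ has_Mpartition M8 (induced S).
Proof.
rewrite has_M10P; split=> -[Ssym S8]; split=> //.
  by move=> x y xS yS; exact: (Ssym (Sub x xS) (Sub y yS)).
by move=> [x xS] [y yS]; exact: Ssym.
Qed.

(** Minimality would give a partition if [S] were proper. Hence the vertices of a single violation
    exhaust a minimal obstruction, which bounds its order. *)
Lemma obstruction_span (M : 'M[entry]_2) (D : digraph) (S : {set D}) :
  minimal_obstruction M D -> ~ has_Mpartition M (induced S) -> S = setT.
Proof.
by case=> _ Dmin nS; apply/eqP/contraT=> ST; case: nS; apply/Dmin;
  rewrite properT.
Qed.

(** * Three-vertex sets and the obstructions for [M9] *)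

Lemma cards3 (T : finType) (x y z : T) :
  x != y -> x != z -> y != z -> #|[set x; y; z]| = 3.
Proof.
by move=> xy xz yz; rewrite -setUA !cardsU1 cards1 !inE negb_or xy xz yz.
Qed.

Lemma two_of_card2 (T : finType) (S : {set T}) x y z :
  #|S| <= 2 -> x \in S -> y \in S -> z \in S -> x != z -> y != z -> x = y.
Proof.
move=> S2 xS yS zS xz yz; apply/eqP; apply: contraLR S2 => xy.
rewrite -ltnNge -(cards3 xy xz yz).
by apply/subset_leq_card/subsetP=> u; rewrite !inE => /orP[/orP[]|] /eqP->.
Qed.

Lemma proper_card3 (T : finType) (S : {set T}) :
  #|T| = 3 -> S \proper setT -> #|S| <= 2.
Proof. by move=> T3 /proper_card; rewrite cardsT T3. Qed.

(** A violation consists of distinct [x], [y], [z] with different arcs into [z], and these span. On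
    at most two vertices [x] and [y] coincide, so no violation fits. *)
Lemma minimal_M9P (D : digraph) :
  minimal_obstruction M9 D <-> #|D| = 3 /\ ~ has_Mpartition M9 D.
Proof.
split=> [Dmin|[D3 nD]]; last first.
  split=> // S /(proper_card3 D3) S2.
  apply/has_M9_inducedP => x y z xS yS zS xz yz.
  by rewrite (two_of_card2 S2 xS yS zS xz yz).
split; last by case: Dmin.
apply/eqP/contraT=> D3; case: (Dmin) => + _; case; apply/has_M9P => x y z xz yz.
apply/eqP/contraT=> arcs.
have xy : x != y by apply: contraNneq arcs => ->.
have S3 : #|[set x; y; z]| = 3 by rewrite cards3.
case/eqP: D3; rewrite -cardsT -(obstruction_span (S := [set x; y; z]) Dmin) //.
move/has_M9_inducedP=> S9; case/eqP: arcs.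
by apply: S9; rewrite ?inE ?eqxx ?orbT.
Qed.

(** * Obstructions for [M8] *)

Lemma not_has_M8 (D : digraph) :
  ~ has_Mpartition M8 D ->
  exists x x' y y' : D, [/\ arc x x', arc y y', x != y & ~~ arc x y].
Proof.
move=> nD; have [|/existsPn none] := boolP [exists u : D * D * (D * D),
  [&& arc u.1.1 u.1.2, arc u.2.1 u.2.2, u.1.1 != u.2.1 & ~~ arc u.1.1 u.2.1]].
  by case/existsP=> [[[x x'] [y y']]] /and4P[]; exists x, x', y, y'.
case: nD; apply/has_M8P => x x' y y' xx' yy' xy.
by have := none ((x, x'), (y, y')); rewrite /= xx' yy' xy negbK.
Qed.

Lemma twoK2_edge_cover (p q r : twoK2) :
  twoK2_edge p q -> r.1 = p.1 -> r = p \/ r = q.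
Proof.
case: p q r => [i j] [i' j'] [k l] /= /andP[/= /eqP <- jj'] ->.
by move: jj'; case: (ord2P j) => ->; case: (ord2P j') => -> // _;
  case: (ord2P l) => ->; auto.
Qed.

Lemma superorientation_twoK2_minimal (D : digraph) :
  is_superorientation twoK2 D -> minimal_obstruction M8 D.
Proof.
case=> f [g fK gK] fE.
(* However its edge is oriented, each copy of K_2 contains a non-sink; non-sinks of different copies
   are not adjacent. *)
have source i : exists x x', arc x x' /\ (f x).1 = i.
  have : edge (f (g (i, ord0) : D)) (f (g (i, ord_max))).
    by rewrite !gK /= /twoK2_edge /= eqxx.
  by rewrite fE => /orP[a|a]; [exists (g (i, ord0)), (g (i, ord_max))
    | exists (g (i, ord_max)), (g (i, ord0))]; rewrite gK.
split=> [/has_M8P D8|S SD].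
  have [x [x' [xx' fx]]] := source ord0;
  have [y [y' [yy' fy]]] := source ord_max.
  have xy : x != y by apply: contra_eqN fx => /eqP->; rewrite fy.
  have : edge (f x) (f y) by rewrite fE (D8 x x' y y').
  by rewrite /= /twoK2_edge fx fy.
apply/has_M8_inducedP => x x' xS x'S y y' yS y'S xx' yy' xy.
have fxx' : twoK2_edge (f x) (f x') by have /= -> := fE x x'; rewrite xx'.
have fyy' : twoK2_edge (f y) (f y') by have /= -> := fE y y'; rewrite yy'.
have [fxy|fxy] := eqVneq (f y).1 (f x).1.
  (* Both arcs lie in one copy, so [y] is [x'] and the required arc is the given one. *)
  case: (twoK2_edge_cover fxx' fxy) => /(can_inj fK) yE; last by rewrite yE.
  by rewrite yE eqxx in xy.
(* The arcs lie in different copies, so their four ends are all the vertices and [S] is not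
   proper. *)
case/negP: (proper_neq SD); apply/eqP/setP=> v; rewrite inE.
have : (f v).1 = (f x).1 \/ (f v).1 = (f y).1.
  by move: fxy; case: (ord2P (f x).1) => ->; case: (ord2P (f y).1) => -> // _;
    case: (ord2P (f v).1) => ->; auto.
by case=> [/(twoK2_edge_cover fxx')|/(twoK2_edge_cover fyy')];
  case=> /(can_inj fK)->.
Qed.

(** The two arcs of a violation span. Unless there are three vertices, they are disjoint and no arc
    joins one to the other; their reversals remain free, whence all superorientations. *)
Lemma minimal_M8P (D : digraph) :
  minimal_obstruction M8 D <->
  (#|D| = 3 /\ ~ has_Mpartition M8 D) \/ is_superorientation twoK2 D.
Proof.
split=> [Dmin|[[D3 nD]|]]; last exact: superorientation_twoK2_minimal.
  have [D3|D3] := eqVneq #|D| 3; [by left; case: Dmin | right].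
  have span (x x' y y' : D) : arc x x' -> arc y y' -> x != y -> ~~ arc x y ->
      [set x; x'; y; y'] = [set: D].
    move=> xx' yy' xy nxy; apply: (obstruction_span Dmin).
    move=> /has_M8_inducedP/(_ x x')S8; case/negP: nxy; move: xx' yy' xy.
    by apply: S8; rewrite !inE eqxx ?orbT.
  (* A violation whose last vertex [y'] repeats an earlier one would span only three vertices,
     against [D3]. *)
  have no3 (x x' y y' : D) : arc x x' -> arc y y' -> x != y ->
      y' \in [set x; x'; y] ->
      arc x y.
    move=> xx' yy' xy y'S; apply: contraNT D3 => nxy.
    rewrite -cardsT -(span x x' y y') // setUC (setUidPr _) ?sub1set //.
    rewrite cards3 ?(arc_neq xx') //.
    by apply: contraNneq nxy => <-.
  have [x [x' [y [y' [xx' yy' xy nxy]]]]] := not_has_M8 Dmin.1.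
  have cover v : [\/ v = x, v = x', v = y | v = y'].
    have : v \in [set x; x'; y; y'] by rewrite span.
    by rewrite !inE -!orbA => /or4P[] /eqP; [constructor 1 | constructor 2
      | constructor 3 | constructor 4].
  have [x'x y'y] : x' != x /\ y' != y.
    by split; rewrite eq_sym; apply: arc_neq.
  have x'y : x' != y by apply: contraNneq nxy => <-.
  (* Each crossing arc is excluded in turn: it would make two non-sinks visible within three
     vertices, so [no3] would force an arc already known to be absent. *)
  have Nyx : ~~ arc y x.
    by apply: contra nxy => yx; apply: (no3 x x' y x); rewrite // !inE eqxx.
  have y'x : y' != x by apply: contraNneq Nyx => <-.
  have Nxy' : ~~ arc x y'.
    by apply: contra nxy => a; apply: (no3 x y' y y');
      rewrite // !inE eqxx orbT.
  have Nyx' : ~~ arc y x'.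
    by apply: contra nxy => a; apply: (no3 x x' y x');
      rewrite // !inE eqxx orbT.
  have x'y' : x' != y' by apply: contraNneq Nyx' => ->.
  have Nx'y : ~~ arc x' y.
    by apply: contra Nyx' => a; apply: (no3 y y' x' y);
      rewrite // 1?eq_sym // !inE eqxx.
  have Ny'x : ~~ arc y' x.
    by apply: contra Nxy' => a; apply: (no3 x x' y' x);
      rewrite // 1?eq_sym // !inE eqxx.
  have Nx'y' : ~~ arc x' y'.
    by apply: contra Nx'y => a; apply: (no3 x' y' y y');
      rewrite // !inE eqxx orbT.
  have Ny'x' : ~~ arc y' x'.
    by apply: contra Ny'x => a; apply: (no3 y' x' x x');
      rewrite // !inE eqxx orbT.
  (* The first coordinate tells the two arcs apart, the second separates their tails [x], [y] from
     their heads. *)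
  pose f (v : D) : twoK2 := (if v \in [:: x; x'] then ord0 else ord_max,
                             if v \in [:: x; y] then ord0 else ord_max).
  have fx : f x = (ord0, ord0) by rewrite /f !inE !eqxx.
  have fx' : f x' = (ord0, ord_max).
    by rewrite /f !inE !eqxx (negPf x'x) (negPf x'y).
  have fy : f y = (ord_max, ord0).
    by rewrite /f !inE !eqxx !(eq_sym y) (negPf xy) (negPf x'y).
  have fy' : f y' = (ord_max, ord_max).
    by rewrite /f !inE (negPf y'x) (negPf y'y) [y' == x']eq_sym (negPf x'y').
  have fI : injective f.
    by move=> u v; case: (cover u) => ->; case: (cover v) => ->;
      rewrite ?fx ?fx' ?fy ?fy'.
  exists f.
    apply: (inj_card_bij fI).
    rewrite card_prod !card_ord -cardsT -(span x x' y y') // setUC cardsU1.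
    by rewrite (cards3 (arc_neq xx') xy x'y) !inE !negb_or y'x y'y eq_sym x'y'.
  move=> u v; case: (cover u) => ->; case: (cover v) => ->;
    rewrite ?fx ?fx' ?fy ?fy' ?arc_irr ?xx' ?yy' ?orbT //= /twoK2_edge /=;
    by apply/esym/negbTE; rewrite negb_or; apply/andP.
split=> // S /(proper_card3 D3) S2.
apply/has_M8_inducedP => x x' xS x'S y y' yS y'S xx' yy' xy.
(* With at most two vertices available, [x'] and [y], both distinct from [x], coincide. *)
suff <- : x' = y by [].
by apply: (two_of_card2 S2 x'S yS xS); rewrite eq_sym ?(arc_neq xx').
Qed.

(** * Obstructions for [M10] *)

(** The ends of a one-way arc already violate symmetry and hence span. Without such an arc the
    digraph and its induced subdigraphs are symmetric, and there [M10]- and [M8]-partitions exist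
    simultaneously. *)
Lemma minimal_M10P (D : digraph) :
  minimal_obstruction M10 D <->
  diso D asymmetric_arc \/ symmetric (@arc D) /\ minimal_obstruction M8 D.
Proof.
split=> [Dmin|[[f fbij fE]|[Dsym [nD Dmin]]]].
- have [/existsP[[x y] /= /andP[xy nyx]]|/existsPn none] :=
    boolP [exists u : D * D, arc u.1 u.2 && ~~ arc u.2 u.1]; last first.
    right; have Dsym : symmetric (@arc D).
      move=> x y; have := none (x, y); have := none (y, x) => /=.
      by case: (arc x y); case: (arc y x).
    split=> //; split=> [D8|S /Dmin.2]; last by case/has_M10_inducedP.
    by case: Dmin => + _; apply; apply/has_M10P.
  left; have spanD : [set x; y] = [set: D].
    apply: (obstruction_span Dmin) => /has_M10_inducedP[/(_ x y)].
    by rewrite !inE !eqxx orbT xy => /(_ isT isT) yx; rewrite -yx in nyx.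
  have cover v : v = x \/ v = y.
    by have : v \in [set x; y];
          [rewrite spanD | rewrite !inE => /orP[]/eqP; auto].
  pose f (v : D) : asymmetric_arc := if v == x then ord0 else ord_max.
  have fx : f x = ord0 by rewrite /f eqxx.
  have fy : f y = ord_max by rewrite /f eq_sym (negPf (arc_neq xy)).
  exists f.
    apply: inj_card_bij => [u v|].
      by case: (cover u) => ->; case: (cover v) => ->; rewrite ?fx ?fy.
    by rewrite card_ord -cardsT -spanD cards2 (arc_neq xy).
  move=> u v; case: (cover u) => ->; case: (cover v) => ->;
    by rewrite ?fx ?fy ?arc_irr ?xy ?(negPf nyx).
- have [g _ gK] := fbij; split=> [/has_M10P[Dsym _]|S SD].
    have := Dsym (g ord0) (g ord_max).
    by rewrite -!fE !gK.
  have S1 : #|S| <= 1.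
    by have := proper_card SD; rewrite cardsT (bij_eq_card fbij) card_ord.
  have eqS u v : u \in S -> v \in S -> u = v.
    by move=> uS vS; apply: (card_le1_eqP S1).
  apply/has_M10_inducedP; split=> [x y xS yS|]; first by rewrite (eqS x y).
  apply/has_M8_inducedP => x x' xS x'S y y' yS y'S _ _.
  by rewrite (eqS x y) ?eqxx.
split=> [/has_M10P[_ //]|S SD].
by apply/has_M10_inducedP; split; [move=> x y _ _; apply: Dsym | apply: Dmin].
Qed.

(** The violating [x] and [y] are non-adjacent non-sinks, so both have an arc to the third vertex
    [x'], the middle of the path. *)
Lemma diso_P3P (D : digraph) :
  diso D (biorientation P3) <->
  symmetric (@arc D) /\ #|D| = 3 /\ ~ has_Mpartition M8 D.
Proof.
split=> [[f fbij fE]|[Dsym [D3 nD]]].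
  split=> [x y|]; first by rewrite -!fE [LHS]edge_sym.
  split; first by rewrite (bij_eq_card fbij) card_ord.
  have [g _ gK] := fbij => /has_M8P D8.
  pose i1 : 'I_3 := Ordinal (isT : 1 < 3).
  have := D8 (g ord0) (g i1) (g ord_max) (g i1).
  by rewrite -!fE -(inj_eq (bij_inj fbij)) !gK /= => /(_ isT isT isT).
have [x [x' [y [y' [xx' yy' xy nxy]]]]] := not_has_M8 nD.
have xx'N := arc_neq xx'.
have x'y : x' != y by apply: contraNneq nxy => <-.
have spanD : [set x; x'; y] = [set: D].
  by apply/eqP; rewrite eqEcard subsetT cardsT D3 cards3.
have cover v : [\/ v = x, v = x' | v = y].
  have : v \in [set x; x'; y] by rewrite spanD.
  by rewrite !inE -orbA => /or3P[] /eqP; [constructor 1 | constructor 2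
    | constructor 3].
have yx' : arc y x'.
  case: (cover y') yy' => ->; rewrite ?arc_irr //.
  by rewrite Dsym (negPf nxy).
pose f (v : D) : biorientation P3 :=
  if v == x then ord0 else if v == x' then Ordinal (isT : 1 < 3) else ord_max.
have fx : f x = ord0 by rewrite /f eqxx.
have fx' : f x' = Ordinal (isT : 1 < 3) by rewrite /f eq_sym (negPf xx'N) eqxx.
have fy : f y = ord_max by rewrite /f !(eq_sym y) (negPf xy) (negPf x'y).
exists f.
  apply: inj_card_bij => [u v|]; last by rewrite card_ord D3.
  by case: (cover u) => ->; case: (cover v) => ->; rewrite ?fx ?fx' ?fy.
move=> u v; case: (cover u) => ->; case: (cover v) => ->;
  rewrite ?fx ?fx' ?fy ?arc_irr ?xx' ?yx' //;
  by rewrite Dsym ?xx' ?yx' ?(negPf nxy) // Dsym (negPf nxy).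
Qed.

Lemma diso_biorientationP (G : sgraph) (D : digraph) :
  diso D (biorientation G) <-> symmetric (@arc D) /\ is_superorientation G D.
Proof.
split=> [[f fbij fE]|[Dsym [f fbij fE]]].
  have Dsym : symmetric (@arc D) by move=> x y; rewrite -!fE [LHS]edge_sym.
  by split=> //; exists f => // x y; rewrite [arc y x]Dsym orbb -fE.
by exists f => // x y; rewrite [LHS]fE [arc y x]Dsym orbb.
Qed.

Theorem theorem2 :
  (forall D : digraph,
     minimal_obstruction M8 D <->
     (#|D| = 3 /\ ~ has_Mpartition M8 D) \/ is_superorientation twoK2 D) /\
  (forall D : digraph,
     minimal_obstruction M9 D <-> #|D| = 3 /\ ~ has_Mpartition M9 D) /\
  (forall D : digraph,
     minimal_obstruction M10 D <->
     [\/ diso D asymmetric_arc, diso D (biorientation twoK2)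
       | diso D (biorientation P3)]).
Proof.
split; first exact: minimal_M8P.
split; first exact: minimal_M9P.
move=> D; rewrite minimal_M10P minimal_M8P.
(* Among the [M8]-obstructions, symmetry singles out P_3 on three vertices and the biorientation
   among the superorientations of 2K_2. *)
split=> [[asym|[Dsym [D3|D2]]]|[asym|/diso_biorientationP[]|/diso_P3P[]]].
- by apply: Or31.
- by apply: Or33; apply/diso_P3P.
- by apply: Or32; apply/diso_biorientationP.
- by left.
- by right; split=> //; right.
- by right; split=> //; left.
Qed.
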